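(* Let $M$ be a cactus configuration. Then $M$ is realizable (i.e. $\Gamma_M\neq\emptyset$) and the matroid variety $V_M$ is irreducible.
   Context: A point-line configuration is a simple matroid (no loops, no parallel elements) of rank at most three on a finite ground set, say $[d]=\{1,\dots,d\}$. Its elements are called points. A line is a maximal dependent subset with at least three elements all of whose three-element subsets are circuits; $\mathcal L_M$ is the set of lines and $\mathcal L_p$ the set of lines containing the point $p$; the degree of $p$ is $|\mathcal L_p|$. Realizations: for a matroid $M$ of rank at most three on $[d]$, $\Gamma_M$ is the set of $\gamma=(\gamma_1,\dots,\gamma_d)\in(\mathbb C^3)^d$ such that for every subset $\{i_1,\dots,i_k\}\subset[d]$: $\{i_1,\dots,i_k\}$ is dependent in $M$ if and only if the vectors $\gamma_{i_1},\dots,\gamma_{i_k}$ are linearly dependent. $V_M$ is the Zariski closure of $\Gamma_M$. Cycle: a point-line configuration with $n$ lines is a cycle if there are points $p_1,\dots,p_n$ and an ordering $l_1,\dots,l_n$ of its lines such that each $p_i$ lies on precisely two lines, namely $l_i$ and $l_{i+1}$ (with $l_{n+1}=l_1$), and every other point lies on exactly one line. Free gluing: for point-line configurations $M$ on $[d_1]$, $N$ on $[d_2]$ and points $p\in[d_1]$, $q\in[d_2]$, the free gluing $M\amalg_{p,q}N$ is the point-line configuration on the disjoint union of the two ground sets with $p$ and $q$ identified to one point $P$, whose lines are exactly the lines of $M$ and the lines of $N$ (with $p$, $q$ replaced by $P$). Cactus: a connected cactus configuration is a point-line configuration $M$ for which there is a sequence $N_1,\dots,N_k=M$ such that $N_1$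 is a single line (i.e. $U_{2,m}$ with $m\ge 3$) or a cycle, and each $N_{i+1}$ is a free gluing of $N_i$ with a line or a cycle. A cactus configuration is a point-line configuration each of whose connected components (restrictions to the classes of the equivalence relation on points generated by lying on a common line) is a connected cactus configuration. *)

(* Defs.v *)
From mathcomp Require Import classical_sets reals complex mpoly.
From mathcomp Require Import all_boot all_order all_algebra.

Set Implicit Arguments.
Unset Strict Implicit.
Unset Printing Implicit Defensive.

Import GRing.Theory.

(** * Matroids *)

Record matroid (T : finType) := Matroid {
  indep : {set {set T}};
  indep_set0 : set0 \in indep;
  indep_sub : forall I J : {set T}, J \subset I -> I \in indep -> J \in indep;
  indep_augment : forall I J : {set T},
    I \in indep -> J \in indep -> #|I| < #|J| ->
    exists2 x, x \in J :\: I & x |: I \in indep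
}.

Section Matroids.
Variables (T : finType) (M : matroid T).
Implicit Types (A B C L : {set T}) (x y p : T).

Definition dependent A := A \notin indep M.

Definition circuit C := minset dependent C.

Definition mrank := \max_(I in indep M) #|I|.

Definition loop x := circuit [set x].

Definition parallel x y := (x != y) && circuit [set x; y].

Definition simple_matroid :=
  [forall x, ~~ loop x] && [forall x, forall y, ~~ parallel x y].

Definition point_line_config := simple_matroid && (mrank <= 3).

(* The maximality of a line is among all sets with the displayed property, not
   among all dependent sets (the whole ground set is usually dependent). *)
Definition collinear_set A :=
  [&& dependent A, 3 <= #|A| &
      [forall B : {set T}, (B \subset A) && (#|B| == 3) ==> circuit B]].

Definition lines : {set {set T}} := [set L | maxset collinear_set L].

Definition lines_through p := [set L in lines | p \in L].

Definition degree p := #|lines_through p|.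

(* The uniform matroid U_{2,m}, with m = #|T| at least 3. *)
Definition single_line :=
  (3 <= #|T|) && [forall A : {set T}, (A \in indep M) == (#|A| <= 2)].

(* [ordS] is the cyclic successor on 'I_n.  Since the p_i are distinct and have
   degree exactly 2, a nonempty cycle automatically has n >= 3. *)
Definition cycle_config : Prop :=
  point_line_config /\
  exists (n : nat) (p : 'I_n -> T) (l : 'I_n -> {set T}),
    [/\ injective p,
        injective l /\ lines = [set l i | i : 'I_n],
        forall i, degree (p i) = 2
                  /\ lines_through (p i) = [set l i; l (ordS i)]
      & forall x, (forall i, x != p i) -> degree x = 1].

Definition share_line : rel T :=
  fun x y => [exists L in lines, (x \in L) && (y \in L)].

(* [connect] is the reflexive transitive closure; [share_line] is symmetric. *)
Definition component x : {set T} := [set y | connect share_line x y].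

End Matroids.

(** * Restriction *)

Section Restriction.
Variables (T : finType) (M : matroid T) (S : {set T}).

Definition restrict_type : finType := {x : T | x \in S}.

Definition restrict_indep : {set {set restrict_type}} :=
  [set I : {set restrict_type} | val @: I \in indep M].

Lemma restrict_indep_set0 : set0 \in restrict_indep.
Proof. by rewrite inE imset0 indep_set0. Qed.

Lemma restrict_indep_sub (I J : {set restrict_type}) :
  J \subset I -> I \in restrict_indep -> J \in restrict_indep.
Proof. by rewrite !inE => JI; apply: indep_sub; apply: imsetS. Qed.

Lemma restrict_indep_augment (I J : {set restrict_type}) :
  I \in restrict_indep -> J \in restrict_indep -> #|I| < #|J| ->
  exists2 x, x \in J :\: I & x |: I \in restrict_indep.
Proof.
rewrite !inE => HI HJ lIJ.
have lv : #|val @: I| < #|val @: J| by rewrite !card_imset //; apply: val_inj.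
have [_ /setDP[/imsetP[x xJ ->] xI] H] := indep_augment HI HJ lv.
exists x; last by rewrite inE imsetU1.
by rewrite inE xJ andbT; apply: contra xI => xI; apply: imset_f.
Qed.

Definition restrict : matroid restrict_type :=
  Matroid restrict_indep_set0 restrict_indep_sub restrict_indep_augment.

End Restriction.

(** * Free gluings and cactus configurations *)

(* [f] and [g] exhibit [T] as the disjoint union of [T1] and [T2] with [p] and
   [q] identified.  A point-line configuration is determined by its lines, so
   this determines [G] up to relabelling of the points. *)
Definition free_gluing (T1 T2 T : finType) (M : matroid T1) (N : matroid T2)
    (p : T1) (q : T2) (G : matroid T) : Prop :=
  point_line_config G /\
  exists (f : T1 -> T) (g : T2 -> T),
    [/\ injective f /\ injective g,
        forall x y, f x = g y <-> x = p /\ y = q,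
        forall z, (exists x, z = f x) \/ (exists y, z = g y)
      & lines G = [set f @: L | L : {set T1} in lines M]
                  :|: [set g @: L | L : {set T2} in lines N]].

Inductive connected_cactus : forall T : finType, matroid T -> Prop :=
| cactus_line (T : finType) (M : matroid T) :
    single_line M -> connected_cactus M
| cactus_cycle (T : finType) (M : matroid T) :
    cycle_config M -> connected_cactus M
| cactus_glue (T1 T2 T : finType) (N : matroid T1) (L : matroid T2)
    (p : T1) (q : T2) (M : matroid T) :
    connected_cactus N -> single_line L \/ cycle_config L ->
    free_gluing N L p q M -> connected_cactus M.

Definition cactus (T : finType) (M : matroid T) : Prop :=
  point_line_config M /\
  forall x : T, connected_cactus (restrict M (component M x)).

(** * The Zariski topology on (F^n)^d, identified with d x n matrices *)

Local Open Scope ring_scope.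

Section Zariski.
Variables (F : fieldType) (d n : nat).
Implicit Types (A Z V : set 'M[F]_(d, n)).

Definition zero_locus (P : set {mpoly F[d * n]}) : set 'M[F]_(d, n) :=
  fun a => forall f, P f -> f.@[fun k => mxvec a 0 k] = 0.

Definition zariski_closed Z : Prop := exists P, Z = zero_locus P.

Definition zariski_closure A : set 'M[F]_(d, n) :=
  fun a => forall Z, zariski_closed Z -> (A `<=` Z)%classic -> Z a.

Definition zariski_irreducible V : Prop :=
  (exists a, V a) /\
  forall Z1 Z2, zariski_closed Z1 -> zariski_closed Z2 ->
    (V `<=` Z1 `|` Z2)%classic -> (V `<=` Z1)%classic \/ (V `<=` Z2)%classic.

End Zariski.

(** * Realizations *)

(* Row i of [a] is the vector attached to the point i.  [free] is applied to the
   family of vectors, so repeated vectors count as dependent.  The coefficient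
   field is the complex field R[i]. *)
Definition realization_space (R : realType) (d : nat) (M : matroid 'I_d) :
    set 'M[R[i]]_(d, 3) :=
  fun a => forall A : {set 'I_d},
    dependent M A <-> ~~ free [seq row i a | i in A].

Arguments realization_space R {d} M _.

Definition matroid_variety (R : realType) (d : nat) (M : matroid 'I_d) :
    set 'M[R[i]]_(d, 3) :=
  zariski_closure (realization_space R M).

Arguments matroid_variety R {d} M _.

(* Main.v *)
Require Import Defs.
From mathcomp Require Import classical_sets reals complex mpoly.
From mathcomp Require Import all_boot all_order all_algebra ring.

(* The points of a cactus configuration can be ordered so that each point lies
   on at most one line containing two earlier points: in a cycle one takes a
   prescribed first point, then the vertices, then the remaining points, and
   such orders are glued along their first point.

   Following such an order, a point is placed either anywhere, or on the plane
   spanned by two earlier vectors; a generic choice creates no unwanted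
   dependency, so a realization exists. Any two realizations are joined by a
   polynomial curve t |-> c(t) all of whose members keep the prescribed
   dependencies; as the independence conditions are open and hold at t = 0, c(t)
   is a realization for all but finitely many t. If polynomials f and g do not
   vanish at the two ends, then f(c(t)) g(c(t)) is a nonzero polynomial in t, so
   the variety is not covered by the zero sets of f and g. *)

Set Implicit Arguments.
Unset Strict Implicit.
Unset Printing Implicit Defensive.


(** * Collinear triples in simple matroids *)

Section SimpleMatroids.
Variables (T : finType) (M : matroid T).
Implicit Types (A L : {set T}) (x y z : T).

(** Degenerate triples count as collinear, so that the predicate matches the vanishing of a
    determinant without distinctness conditions. *)
Definition collinear3 x y z :=
  [|| x == y, x == z, y == z | dependent M [set x; y; z]].

Lemma collinear3C x y z : collinear3 x y z = collinear3 x z y.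
Proof. by rewrite /collinear3 setUAC (eq_sym z y); do 2!bool_congr. Qed.

Lemma collinear3CA x y z : collinear3 x y z = collinear3 y x z.
Proof. by rewrite /collinear3 (eq_sym y x) [[set y; x]]setUC; do 2!bool_congr. Qed.

Lemma cards3 x y z : (#|[set x; y; z]| == 3) = uniq [:: x; y; z].
Proof.
have -> : #|[set x; y; z]| = #|[:: x; y; z]|.
  by apply: eq_card => t; rewrite !inE orbA.
by apply/eqP/idP => /card_uniqP.
Qed.

(** A nonempty circuit of size at most two would be a loop or a parallel pair. *)
Lemma indep_card_le2 A : simple_matroid M -> #|A| <= 2 -> A \in indep M.
Proof.
case/andP=> /forallP noloop /forallP nopar A2; apply/negPn/negP => dA.
have [C cC sCA] := minset_exists (P := dependent M) dA; have dC := minsetp cC.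
have := leq_trans (subset_leq_card sCA) A2.
case E: #|C| => [|[|[|//]]] _.
- by move/eqP: E dC; rewrite cards_eq0 => /eqP ->; rewrite /dependent indep_set0.
- by have /cards1P[x Ex] := introT eqP E; have := noloop x; rewrite /loop /circuit -Ex cC.
- have /cards2P[x [y [xy Ex]]] := introT eqP E; rewrite Ex in cC.
  by have /forallP/(_ y) := nopar x; rewrite /parallel xy /circuit cC.
Qed.

(** Pairs being independent, a dependent triple is a circuit, hence extends to a maximal collinear
    set. *)
Lemma collinear3_line x y z : simple_matroid M -> uniq [:: x; y; z] ->
  collinear3 x y z -> exists2 L, L \in lines M & [/\ x \in L, y \in L & z \in L].
Proof.
move=> sM U; have /eqP c3 : #|[set x; y; z]| == 3 by rewrite cards3.
rewrite /collinear3; move: (U); rewrite /= !inE negb_or -andbA.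
case/and4P=> /negPf-> /negPf-> /negPf-> _ /= dA.
have [|L mL sAL] := maxset_exists (P := collinear_set M) (C := [set x; y; z]).
  rewrite /collinear_set dA c3 /=; apply/forallP => B; apply/implyP.
  case/andP=> sB /eqP B3; apply/minsetP.
  have -> : B = [set x; y; z] by apply/eqP; rewrite eqEcard sB c3 B3.
  split=> // C dC sC; apply/eqP; rewrite eqEcard sC c3 ltnNge.
  by apply: contra dC; apply: indep_card_le2.
exists L; first by rewrite inE.
by split; apply: (subsetP sAL); rewrite !inE eqxx ?orbT.
Qed.

Lemma line_collinear3 L x y z :
  L \in lines M -> x \in L -> y \in L -> z \in L -> collinear3 x y z.
Proof.
rewrite inE => /maxsetp/and3P[_ _ /forallP H] xL yL zL.
rewrite /collinear3; case: eqVneq => //= xy; case: eqVneq => //= xz.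
case: eqVneq => //= yz.
have /implyP/(_ _)/minsetp := H [set x; y; z]; apply; apply/andP; split.
  by apply/subsetP => t; rewrite !inE => /orP[/orP[]|] /eqP->.
by rewrite cards3 /= !inE negb_or xy xz yz.
Qed.

(** Were [x], [z], [t] independent, augmentation would add [z] or [t] to [[set x; y]], against one
    of the two hypotheses. *)
Lemma collinear3_trans x y z t : simple_matroid M -> x != y ->
  collinear3 x y z -> collinear3 x y t -> collinear3 x z t.
Proof.
move=> sM xy cz ct; apply/negPn/negP.
rewrite {1}/collinear3 !negb_or negbK => /and4P[xz xt zt Iztx].
have I2 : [set x; y] \in indep M by apply: indep_card_le2; rewrite // cards2; case: (_ == _).
have lt23 : #|[set x; y]| < #|[set x; z; t]|.
  suff /eqP -> : #|[set x; z; t]| == 3 by rewrite cards2 xy.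
  by rewrite cards3 /= !inE negb_or xz xt zt.
have [w] := indep_augment I2 Iztx lt23.
rewrite !inE negb_or => /andP[/andP[wx wy] wzt].
rewrite -[_ :|: _]setUC => Iw.
have : collinear3 x y w.
  by move: wzt; rewrite (negPf wx) /= => /orP[] /eqP->.
by rewrite /collinear3 (negPf xy) !(eq_sym _ w) (negPf wx) (negPf wy) /dependent Iw.
Qed.

End SimpleMatroids.

(** * Placement orders for lines and cycles *)

(* A list is read from its end: the points following x in s are those placed
   before x. *)
Fixpoint all_prefix (T : Type) (P : seq T -> T -> Prop) (s : seq T) : Prop :=
  if s is x :: s' then P s' x /\ all_prefix P s' else True.

Lemma all_prefix_cat (T : eqType) (P : seq T -> T -> Prop) (s1 s2 : seq T) :
  uniq (s1 ++ s2) -> all_prefix P s2 ->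
  (forall t1 x t2, s1 = t1 ++ x :: t2 -> x \notin t2 ++ s2 -> P (t2 ++ s2) x) ->
  all_prefix P (s1 ++ s2).
Proof.
move=> + P2; elim: s1 => [|x s1 IH] //= /andP[xs U] H; split.
  exact: (H [::] x s1).
by apply: IH => // t1 y t2 E yt; apply: (H (x :: t1) y t2) => //; rewrite E.
Qed.

Section Orders.
Variable T : finType.
Implicit Types (LL : {set {set T}}) (s : seq T) (L : {set T}).

(** Heavy lines are those that constrain the vector of [x] once the points of [s] have been
    placed. *)
Definition heavy LL s x L :=
  [/\ L \in LL, x \in L &
      exists y z, [/\ y \in s, z \in s, y != z, y \in L & z \in L]].

Definition unique_heavy LL s x :=
  forall L L', heavy LL s x L -> heavy LL s x L' -> L = L'.

(** The counterpart of [unique_heavy] in terms of triples, which is what determinants see.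
    Exchanging [y] and [z] puts both points on the line of [u] and [v]. *)
Definition unique_collinear (M : matroid T) s x :=
  forall y z u v, [/\ y \in s, z \in s, u \in s & v \in s] ->
    y != z -> u != v -> collinear3 M x y z -> collinear3 M x u v ->
    collinear3 M u v y.

Lemma all_prefix_unique_collinear (M : matroid T) s :
  simple_matroid M -> uniq s ->
  all_prefix (unique_heavy (lines M)) s -> all_prefix (unique_collinear M) s.
Proof.
move=> sM; elim: s => //= x s IH /andP[xs Us] [Px Ps]; split; last exact: IH.
move=> y z u v [ys zs us vs] yz uv cxyz cxuv.
have neq t : t \in s -> x != t by apply: contraTneq => <-.
have [|L LM [xL yL zL]] := collinear3_line sM _ cxyz.
  by rewrite /= !inE negb_or !neq ?yz.
have [|L' LM' [xL' uL' vL']] := collinear3_line sM _ cxuv.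
  by rewrite /= !inE negb_or !neq ?uv.
have E : L = L'.
  by apply: Px; split=> //; [exists y, z | exists u, v].
by rewrite -E in uL' vL'; apply: (line_collinear3 LM).
Qed.

(** The whole ground set is collinear here, so it is the only maximal collinear set. *)
Lemma single_line_lines (M : matroid T) L L' :
  single_line M -> L \in lines M -> L' \in lines M -> L = L'.
Proof.
case/andP=> T3 /forallP H.
suff lineT K : K \in lines M -> K = setT by move=> /lineT-> /lineT->.
rewrite inE => /maxsetP[_ maxK]; apply/esym/maxK; last exact: subsetT.
rewrite /collinear_set /dependent (eqP (H _)) cardsT -ltnNge T3 /=.
apply/forallP => B; apply/implyP => /andP[_ /eqP B3]; apply/minsetP.
rewrite /dependent (eqP (H B)) B3; split=> // C; rewrite (eqP (H C)) -ltnNge => C3 CB.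
by apply/eqP; rewrite eqEcard CB B3.
Qed.

(** Points other than vertices and [q] come last and lie on one line each. A heavy line of a vertex
    must pass through [q], with [q] not a vertex, and then [q] lies on a single line. *)
Lemma cycle_order (M : matroid T) q : cycle_config M ->
  exists s, [/\ uniq (rcons s q), forall x, x \in rcons s q
              & all_prefix (unique_heavy (lines M)) (rcons s q)].
Proof.
case=> _ [n [p [l [injp [injl linesE] H deg1]]]].
pose s1 := [seq x <- enum T | (x \notin codom p) && (x != q)].
pose s2 := [seq x <- enum T | (x \in codom p) && (x != q)].
have mem1 x : (x \in s1) = (x \notin codom p) && (x != q).
  by rewrite mem_filter mem_enum andbT.
have mem2 x : (x \in s2) = (x \in codom p) && (x != q).
  by rewrite mem_filter mem_enum andbT.
have deg1P x L L' : x \notin codom p -> L \in lines M -> L' \in lines M ->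
    x \in L -> x \in L' -> L = L'.
  move=> xp LM LM' xL xL'.
  have /eqP/cards1P[K E] : degree M x = 1.
    by apply: deg1 => i; apply: contra xp => /eqP->; apply: codom_f.
  have : L \in lines_through M x by rewrite inE LM.
  have : L' \in lines_through M x by rewrite inE LM'.
  by rewrite E !inE => /eqP-> /eqP->.
have vertex j i : p i \in l j -> i = j \/ ordS i = j.
  move=> pl; have : l j \in lines_through M (p i).
    by rewrite inE pl linesE imset_f.
  by rewrite (H i).2 !inE => /orP[] /eqP/injl; [left | right].
have U : uniq (s1 ++ s2 ++ [:: q]).
  rewrite cats1 cat_uniq rcons_uniq !(filter_uniq _ (enum_uniq T)) mem2.
  rewrite eqxx andbF !andbT; apply/hasPn => x.
  rewrite mem_rcons inE /= mem1 mem2.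
  by case: eqVneq => [_|_] /=; rewrite ?andbF ?andbT ?negbK.
exists (s1 ++ s2); split.
- by rewrite -cats1 -catA.
- move=> x; rewrite mem_rcons inE mem_cat mem1 mem2.
  by case: eqVneq => //= _; rewrite !andbT orNb.
rewrite -cats1 -catA; apply: all_prefix_cat => //.
  apply: all_prefix_cat; first by move: U; rewrite cat_uniq => /and3P[].
    by split=> // L L' [_ _ [y [z []]]].
  move=> t1 x t2 E xt.
  have xp : x \in codom p.
    have : x \in s2 by rewrite E mem_cat inE eqxx orbT.
    by rewrite mem2 => /andP[].
  have st t : t \in t2 ++ [:: q] -> (t \in codom p) || (t == q).
    rewrite mem_cat mem_seq1 orbC; case: eqVneq => [->|_ /=]; first by rewrite orbT.
    move=> tt2; have : t \in s2 by rewrite E mem_cat inE tt2 !orbT.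
    by rewrite mem2 => /andP[->].
  (* A line contains at most two vertices, so that besides x and one earlier
     vertex it must contain q. *)
  have heavyq L : heavy (lines M) (t2 ++ [:: q]) x L -> q \in L /\ q \notin codom p.
    case=> LM xL [y [z [ys zs yz yL zL]]].
    have xy : x != y by apply: contraNneq xt => ->.
    have xz : x != z by apply: contraNneq xt => ->.
    suff not3 a b c : a \in codom p -> b \in codom p -> c \in codom p ->
        a != b -> a != c -> b != c -> [/\ a \in L, b \in L & c \in L] -> False.
      have [yp|yp] := boolP (y \in codom p).
        have zp : z \notin codom p by apply/negP => zp; apply: (not3 x y z).
        by move: (st _ zs); rewrite (negPf zp) /= => /eqP <-.
      by move: (st _ ys); rewrite (negPf yp) /= => /eqP <-.
    case/codomP=> i -> /codomP[j ->] /codomP[k ->].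
    move: LM; rewrite linesE => /imsetP[m _ ->].
    move=> ij ik jk [/vertex ai /vertex aj /vertex ak].
    rewrite !(inj_eq injp) in ij ik jk.
    have inS : injective (@ordS n) by apply: can_inj (@ordSK n).
    (* A vertex on [l m] has index [m] or the predecessor of [m]; among three distinct ones two
       would share an alternative. *)
    have not2 u v : u != v -> ~ (u = m /\ v = m) /\ ~ (ordS u = m /\ ordS v = m).
      by move/eqP=> uv; split=> -[Eu Ev]; apply: uv; rewrite ?Eu ?Ev //; apply: inS; rewrite Eu.
    by have [[? ?] [? ?] [? ?]] := And3 (not2 _ _ ij) (not2 _ _ ik) (not2 _ _ jk); tauto.
  move=> L L' h h'; have [qL qp] := heavyq _ h; have [qL' _] := heavyq _ h'.
  by case: h h' => LM _ _ [LM' _ _]; apply: (deg1P q).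
move=> t1 x t2 E _ L L' [LM xL _] [LM' xL' _]; apply: (deg1P x) => //.
have : x \in s1 by rewrite E mem_cat inE eqxx orbT.
by rewrite mem1 => /andP[].
Qed.

(** Ending the list with [q] means placing it first, as needed when [q] is glued to a point that is
    already there. For a single line every order works. *)
Lemma block_order (M : matroid T) q : single_line M \/ cycle_config M ->
  exists s, [/\ uniq (rcons s q), forall x, x \in rcons s q
              & all_prefix (unique_heavy (lines M)) (rcons s q)].
Proof.
case=> [sl|]; last exact: cycle_order.
exists (rem q (enum T)); split.
- by rewrite rcons_uniq mem_rem_uniqF ?rem_uniq ?enum_uniq.
- move=> x; rewrite mem_rcons inE mem_rem_uniq ?enum_uniq // inE mem_enum.
  by rewrite andbT orbN.
elim: (rcons _ _) => //= x s IH; split=> // L L' [LM _ _] [LM' _ _].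
exact: single_line_lines LM LM'.
Qed.

End Orders.

(** * Placement orders for cactus configurations *)

(** The points of [L] other than [q] are placed after those of [N]. As [q] is first in its block,
    each of them sees the same earlier points of [L] as before, and its heavy lines come from
    [L]. *)
Lemma free_gluing_order (T1 T2 T : finType) (N : matroid T1) (L : matroid T2)
    (p : T1) (q : T2) (M : matroid T) s1 s2 :
  free_gluing N L p q M ->
  uniq s1 -> (forall x, x \in s1) -> all_prefix (unique_heavy (lines N)) s1 ->
  uniq (rcons s2 q) -> (forall x, x \in rcons s2 q) ->
  all_prefix (unique_heavy (lines L)) (rcons s2 q) ->
  exists s, [/\ uniq s, forall x, x \in s
              & all_prefix (unique_heavy (lines M)) s].
Proof.
case=> _ [f [g [[injf injg] fg cover linesE]]] U1 full1 P1 U2 full2 P2.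
have gqs1 y : (g y \in map f s1) = (y == q).
  apply/mapP/eqP => [[x _ /esym/fg[]]//|->].
  by exists p; rewrite ?full1 //; apply/esym/fg.
have U : uniq (map g s2 ++ map f s1).
  rewrite cat_uniq !map_inj_uniq // U1.
  move: U2; rewrite rcons_uniq => /andP[qs2 ->] /=; rewrite andbT.
  apply: contra qs2 => /hasP[z fx /mapP[y ys2 Ey]].
  by move: fx; rewrite Ey gqs1 => /eqP <-.
exists (map g s2 ++ map f s1); split=> //.
  move=> x; rewrite mem_cat; case: (cover x) => [[y ->]|[y ->]].
    by rewrite (map_f f) ?orbT.
  rewrite gqs1; have := full2 y; rewrite mem_rcons inE => /orP[->|ys].
    by rewrite orbT.
  by rewrite map_f.
(* A line of [L] meets the image of [f] at most in the glued point, so it cannot contain two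
   distinct earlier points. *)
have heavyf s x K : heavy (lines M) (map f s) (f x) K ->
    exists2 K1, heavy (lines N) s x K1 & K = f @: K1.
  rewrite /heavy linesE => -[+ + [_ [_ [/mapP[y ys ->] /mapP[z zs ->] yz]]]].
  case/setUP=> /imsetP[K' K'M ->].
    rewrite !mem_imset // => xK yK zK; exists K' => //.
    by split=> //; exists y, z; split=> //; apply: contraNneq yz => ->.
  move=> _ /imsetP[y' _ /fg[Ey _]] /imsetP[z' _ /fg[Ez _]].
  by move: yz; rewrite Ey Ez eqxx.
(* No line of [N] passes through [g x] when [x != q], and the only point of [L] among [map f s1] is
   [g q]. *)
have heavyg s x K : x != q -> heavy (lines M) (map g s ++ map f s1) (g x) K ->
    exists2 K2, heavy (lines L) (rcons s q) x K2 & K = g @: K2.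
  rewrite /heavy linesE => xq [+ + [y [z [ys zs yz]]]].
  case/setUP=> /imsetP[K' K'M ->].
    by move=> /imsetP[x' _ /esym/fg[_ Ex]]; rewrite Ex eqxx in xq.
  have mems w : g w \in map g s ++ map f s1 -> w \in rcons s q.
    by rewrite mem_cat gqs1 (mem_map injg) mem_rcons inE orbC.
  move=> + /imsetP[y' yK Ey] /imsetP[z' zK Ez].
  rewrite mem_imset // => xK; exists K' => //; split=> //; exists y', z'.
  by split=> //; [apply: mems; rewrite -Ey | apply: mems; rewrite -Ez
                 | apply: contraNneq yz => E; rewrite Ey Ez E].
apply: all_prefix_cat => //.
  elim: s1 P1 {U1 full1 gqs1 U heavyg} => //= x s IH [Px Ps]; split; last exact: IH.
  move=> K K' /heavyf[K1 h1 ->] /heavyf[K2 h2 ->].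
  by rewrite (Px _ _ h1 h2).
move=> t1 x t2 + _; elim: s2 t1 U2 P2 {full2 U} => [|y s IH] [|w t1] //=.
  case/andP=> ys _ [Py _] [<- <-] K K'.
  have yq : y != q by apply: contraNneq ys => ->; rewrite mem_rcons mem_head.
  by move=> /(heavyg _ _ _ yq)[K1 h1 ->] /(heavyg _ _ _ yq)[K2 h2 ->]; rewrite (Py _ _ h1 h2).
by case/andP=> _ U2 [_ P2] [_ E]; apply: IH E.
Qed.

Lemma connected_cactus_simple (T : finType) (M : matroid T) :
  connected_cactus M -> simple_matroid M.
Proof.
case=> {T M} [T M /andP[_ /forallP H] | T M [/andP[]] // | T1 T2 T N L p q M _ _].
  have small (A : {set T}) : #|A| <= 2 -> ~~ circuit M A.
    move=> A2; apply/negP => /minsetp.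
    by rewrite /dependent (eqP (H A)) A2.
  apply/andP; split; apply/forallP => x; first by rewrite small ?cards1.
  by apply/forallP => y; rewrite negb_and small ?orbT // cards2; case: (_ != _).
by case=> /andP[].
Qed.

Lemma connected_cactus_order (T : finType) (M : matroid T) :
  connected_cactus M ->
  exists s, [/\ uniq s, forall x, x \in s
              & all_prefix (unique_heavy (lines M)) s].
Proof.
have base (T' : finType) (M' : matroid T') : single_line M' \/ cycle_config M' ->
    exists s, [/\ uniq s, forall x, x \in s
                & all_prefix (unique_heavy (lines M')) s].
  (* Any point may serve as the first one; an empty ground set gets the empty order. *)
  move=> bM; case: (pickP (@predT T')) => [q _ | no].
    by have [s sP] := block_order q bM; exists (rcons s q).
  by exists [::]; split=> // x; have := no x.
elim=> {T M} [T M ?|T M ?|T1 T2 T N L p q M _ [s1 [U1 full1 P1]] bL glue].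
- by apply: base; left.
- by apply: base; right.
have [s2 [U2 full2 P2]] := block_order q bL.
exact: free_gluing_order glue U1 full1 P1 U2 full2 P2.
Qed.

Lemma collinear3_restrict (T : finType) (M : matroid T) (S : {set T})
    (x y z : restrict_type S) :
  collinear3 (Defs.restrict M S) x y z = collinear3 M (val x) (val y) (val z).
Proof. by rewrite /collinear3 !(inj_eq val_inj) /dependent !inE !imsetU !imset_set1. Qed.

Lemma collinear3_component (T : finType) (M : matroid T) (x y z : T) :
  simple_matroid M -> uniq [:: x; y; z] -> collinear3 M x y z ->
  y \in component M x.
Proof.
move=> sM U /(collinear3_line sM U)[L LM [xL yL _]].
by rewrite inE connect1 //; apply/existsP; exists L; rewrite LM xL.
Qed.

(** Orders of the components are concatenated: a collinear triple of distinct points stays in one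
    component, so the other components do not constrain a point. *)
Lemma cactus_order (T : finType) (M : matroid T) : cactus M ->
  exists s, [/\ uniq s, forall x, x \in s & all_prefix (unique_collinear M) s].
Proof.
case=> /andP[sM _] cM.
have symS : connect_sym (share_line M).
  apply: sym_connect_sym => x y; apply: eq_existsb => L.
  by rewrite [(x \in L) && _]andbC.
have comp x : exists s, [/\ uniq s, s =i component M x
                           & all_prefix (unique_collinear M) s].
  have [s [U full P]] := connected_cactus_order (cM x).
  have {}P := all_prefix_unique_collinear (connected_cactus_simple (cM x)) U P.
  exists (map val s); split; first by rewrite map_inj_uniq //; apply: val_inj.
    move=> y; apply/mapP/idP => [[[z zx] _ ->] //|yx].
    by exists (exist _ y yx).
  elim: s P {U full} => //= w s IH [Pw Ps]; split; last exact: IH.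
  move=> _ _ _ _ [/mapP[y ys ->] /mapP[z zs ->] /mapP[u us ->] /mapP[v vs ->]].
  by rewrite !(inj_eq val_inj) -!collinear3_restrict; apply: Pw.
(* Closure under components is carried through the induction, so that each component is added as a
   whole or is already present. *)
suff [s [U _ full P]] : exists s, [/\ uniq s,
    forall x y, x \in s -> y \in component M x -> y \in s,
    forall x, x \in enum T -> x \in s & all_prefix (unique_collinear M) s].
  by exists s; split=> // x; apply: full; rewrite mem_enum.
elim: (enum T) => [|x e [s [U clos full P]]]; first by exists [::].
have [xs|xs] := boolP (x \in s).
  exists s; split=> // y; rewrite inE => /predU1P[->//|]; exact: full.
have [sx [Ux memx Px]] := comp x.
have disj y : y \in component M x -> y \notin s.
  move=> yx; apply: contra xs => ys; apply: clos ys _.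
  by rewrite inE symS; rewrite inE in yx.
have Uc : uniq (sx ++ s).
  rewrite cat_uniq Ux U andbT /=; apply/hasPn => y ys.
  by apply: contraTN ys => /=; rewrite memx; apply: disj.
exists (sx ++ s); split=> //.
- move=> y z; rewrite !mem_cat => /orP[yx zy|ys /(clos _ _ ys)->]; last by rewrite orbT.
  move: yx zy; rewrite !memx !inE => xy yz.
  by rewrite (connect_trans xy yz).
- move=> y; rewrite inE mem_cat => /predU1P[->|/full->]; last by rewrite orbT.
  by rewrite memx inE connect0.
apply: all_prefix_cat => // t1 w t2 E wt y z u v [yt zt ut vt] yz uv cwyz cwuv.
have xw : w \in component M x by rewrite -memx E mem_cat mem_head orbT.
(* Earlier points collinear with [w] lie in its component, which [s] avoids, hence in [t2]. *)
have near a b : a \in t2 ++ s -> b \in t2 ++ s -> a != b ->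
    collinear3 M w a b -> a \in t2.
  move=> at2 bt2 ab cab.
  have wa : w != a by apply: contraNneq wt => ->.
  have wb : w != b by apply: contraNneq wt => ->.
  have aw : a \in component M w.
    by apply: (collinear3_component sM _ cab); rewrite /= !inE negb_or wa wb ab.
  move: at2; rewrite mem_cat => /orP[//|]; apply: contraTT => _; apply: disj.
  by move: xw aw; rewrite !inE; apply: connect_trans.
have zy : z != y by rewrite eq_sym.
have vu : v != u by rewrite eq_sym.
have Pw : unique_collinear M t2 w.
  by elim: t1 sx E Px {memx Ux Uc} => [|a t1 IH] _ -> /= [] // _ /IH; apply.
apply: (Pw _ _ _ _ _ yz uv cwyz cwuv); split.
- exact: near cwyz.
- by apply: near zt yt zy _; rewrite collinear3C.
- exact: near cwuv.
- by apply: near vt ut vu _; rewrite collinear3C.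
Qed.


(** * Auxiliary facts on triples *)

Lemma cards3P (T : finType) (A : {set T}) : #|A| = 3 ->
  exists x y z, uniq [:: x; y; z] /\ A = [set x; y; z].
Proof.
rewrite cardE; move: (enum_uniq A) (mem_enum A).
case: (enum _) => [|x [|y [|z []]]] // U memA _; exists x, y, z; split=> //.
by apply/setP => t; rewrite -memA !inE orbA.
Qed.

Lemma collinear3_closed (T : finType) (M : matroid T) (y z a b c : T) :
  simple_matroid M -> y != z -> collinear3 M y z a -> collinear3 M y z b ->
  collinear3 M y z c -> collinear3 M a b c.
Proof.
move=> sM yz ca cb cc.
have [<-|ya] := eqVneq y a; first exact: collinear3_trans cb cc.
apply: (@collinear3_trans _ _ a y) => //; first by rewrite eq_sym.
  by rewrite collinear3CA; apply: collinear3_trans ca cb.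
by rewrite collinear3CA; apply: collinear3_trans ca cc.
Qed.

(** By symmetry, triples involving the new point [w] reduce to those with [w] in front. *)
Lemma mem3_cons_ind (T : eqType) (P : T -> T -> T -> Prop) (w : T) (s : seq T) :
  (forall i j, P i i j) -> (forall i j k, P i j k -> P i k j) ->
  (forall i j k, P i j k -> P j i k) ->
  {in s &, forall i j, P w i j} -> {in s & &, forall i j k, P i j k} ->
  {in w :: s & &, forall i j k, P i j k}.
Proof.
move=> P0 PC PCA Pw Ps i j k; rewrite !inE.
case/predU1P=> [->|si] /predU1P[->|sj] /predU1P[->|sk]; auto.
Qed.

Import GRing.Theory Num.Theory.
Local Open Scope ring_scope.

(** * Determinants and freeness of vectors in three-space *)

Section Det3.
Variable R : comNzRingType.
Implicit Types (u v w : 'rV[R]_3).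

(** The determinant is expanded over a commutative ring, so that it also applies to polynomial
    vectors and its identities reduce to [ring]. *)
Definition det3 u v w :=
  u 0 0 * (v 0 1 * w 0 2 - v 0 2 * w 0 1)
  - u 0 1 * (v 0 0 * w 0 2 - v 0 2 * w 0 0)
  + u 0 2 * (v 0 0 * w 0 1 - v 0 1 * w 0 0).

Lemma det3C u v w : det3 u w v = - det3 u v w.
Proof. rewrite /det3; ring. Qed.

Lemma det3CA u v w : det3 v u w = - det3 u v w.
Proof. rewrite /det3; ring. Qed.

Lemma det3_id u w : det3 u u w = 0.
Proof. rewrite /det3; ring. Qed.

Lemma det3_id23 u w : det3 u w w = 0.
Proof. rewrite /det3; ring. Qed.

Lemma det3D u u' v w : det3 (u + u') v w = det3 u v w + det3 u' v w.
Proof. by rewrite /det3 !mxE; ring. Qed.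

Lemma det3Z a u v w : det3 (a *: u) v w = a * det3 u v w.
Proof. by rewrite /det3 !mxE; ring. Qed.

Lemma det3_sum n (a : 'I_n -> R) (f : 'I_n -> 'rV[R]_3) v w :
  det3 (\sum_i a i *: f i) v w = \sum_i a i * det3 (f i) v w.
Proof.
elim/big_rec2: _ => [|i y z _ <-]; last by rewrite det3D det3Z.
by rewrite /det3 !mxE; ring.
Qed.

Lemma det_rows3 u v w : \det (\matrix_(i < 3) nth 0 [:: u; v; w] i) = det3 u v w.
Proof.
rewrite (expand_det_row _ 0) !big_ord_recl big_ord0 /cofactor.
rewrite !(expand_det_row _ (0 : 'I_2)) !big_ord_recl !big_ord0 /cofactor !det_mx11 !mxE /=.
(* Indexing by natural numbers identifies differently written ordinals of equal value, so that
   [ring] sees the same atoms. *)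
have [e eE] : exists e, forall (x : 'rV[R]_3) i, x 0 i = e x (nat_of_ord i).
  by exists (fun x k => x 0 (inord k)) => x i; rewrite inord_val.
rewrite /det3 !eE /= /bump /=.
ring.
Qed.

End Det3.

Lemma det3_map (R S : comNzRingType) (f : {rmorphism R -> S}) (u v w : 'rV[R]_3) :
  det3 (map_mx f u) (map_mx f v) (map_mx f w) = f (det3 u v w).
Proof. by rewrite /det3 !mxE !(rmorphD, rmorphN, rmorphM). Qed.

Section Free.
Variable F : fieldType.

Lemma free_image (T : finType) n (f : T -> 'rV[F]_n) (A : {set T}) (s : seq T) :
  uniq s -> A =i s -> free [seq f i | i in A] = free [seq f i | i <- s].
Proof.
move=> Us As; apply/perm_free/perm_map/uniq_perm => //; first exact: enum_uniq.
by move=> x; rewrite mem_enum As.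
Qed.

Lemma free_row_free m n (X : seq 'rV[F]_n) : size X = m ->
  free X = row_free (\matrix_(i < m) X`_i).
Proof.
move/eqP=> sX.
have fP : reflect (forall k : 'I_m -> F, \sum_i k i *: X`_i = 0 -> forall i, k i = 0)
  (free X) := @freeP _ _ _ (Tuple sX).
apply/fP/idP => [H|H k].
  apply: inj_row_free => v; rewrite mulmx_sum_row => E; apply/rowP => i.
  rewrite [RHS]mxE; apply: (H (v 0)); rewrite -[RHS]E.
  by apply: eq_bigr => j _; rewrite rowK.
move=> E i; have /(row_free_inj H)/rowP/(_ i) :
    (\row_i k i) *m (\matrix_(i < m) X`_i) = 0 *m (\matrix_(i < m) X`_i).
  by rewrite mul0mx -[RHS]E mulmx_sum_row; apply: eq_bigr => j _; rewrite rowK mxE.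
by rewrite !mxE.
Qed.

Lemma free3 (u v w : 'rV[F]_3) : free [:: u; v; w] = (det3 u v w != 0).
Proof.
by rewrite (free_row_free (m := 3)) // row_free_unit unitmxE unitfE det_rows3.
Qed.

Lemma free_image_rows m n (a : 'M[F]_(m, n)) (A : {set 'I_m}) :
  free [seq row i a | i in A] = row_free (rowsub (enum_val (A := A)) a).
Proof.
rewrite (free_row_free (size_image _ _)); congr row_free.
by apply/row_matrixP => i; rewrite row_rowsub rowK (nth_image 0).
Qed.

End Free.

(** * Generic choice of a parameter *)

Section Specialization.
Variable F : numFieldType.

(** The product has fewer roots than its size, while characteristic zero provides that many distinct
    integers. *)
Lemma all_nonroot (ps : seq {poly F}) :
  all (predC1 0) ps -> exists t, all (fun p => ~~ root p t) ps.
Proof.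
move=> ps0; pose q := \prod_(p <- ps) p.
have q0 : q != 0 by rewrite prodf_seq_neq0; apply: sub_all ps0.
pose rs : seq F := [seq i%:R | i <- iota 0 (size q)].
have Urs : uniq rs by rewrite map_inj_uniq ?iota_uniq //; apply: mulrIn; rewrite oner_eq0.
have : ~~ all (root q) rs.
  apply/negP => rq; have := max_poly_roots q0 rq Urs.
  by rewrite size_map size_iota ltnn.
by case/allPn => t _ qt; exists t; rewrite -root_bigmul.
Qed.

Lemma horner_mmap_curve d n (c : 'M[{poly F}]_(d, n)) (f : {mpoly F[d * n]}) t :
  (mmap polyC (fun k => mxvec c 0 k) f).[t]
  = f.@[fun k => mxvec (map_mx (horner_eval t) c) 0 k].
Proof.
rewrite mevalE /mmap horner_sum; apply: eq_bigr => m _.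
rewrite hornerM hornerC /mmap1 horner_prod; congr (_ * _); apply: eq_bigr => k _.
by rewrite horner_exp -map_mxvec mxE.
Qed.

(** With [B] a right inverse at [t0], the determinant of [c] times [B] is a polynomial equal to 1 at
    [t0]; where it is nonzero, the rows are free. *)
Lemma row_free_curve m n (c : 'M[{poly F}]_(m, n)) t0 :
  row_free (map_mx (horner_eval t0) c) ->
  exists2 h : {poly F}, h != 0 &
    forall t, ~~ root h t -> row_free (map_mx (horner_eval t) c).
Proof.
case/row_freeP=> B cB; pose h := \det (c *m map_mx polyC B).
have hE t : h.[t] = \det (map_mx (horner_eval t) c *m B).
  rewrite -horner_evalE -det_map_mx map_mxM -map_mx_comp; congr (\det (_ *m _)).
  by apply/matrixP => i j; rewrite !mxE /= /horner_eval hornerC.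
exists h => [|t].
  by apply/eqP => h0; have /eqP := hE t0; rewrite h0 horner0 cB det1 eq_sym oner_eq0.
rewrite rootE hE -unitfE -unitmxE -row_free_unit => /eqP rk.
by rewrite /row_free eqn_leq rank_leq_row -{1}rk mxrankM_maxl.
Qed.

(** With powers of [t] as coefficients, each determinant is a polynomial in [t] whose coefficients
    are the [det3 b p.1 p.2], not all zero. *)
Lemma generic_combination (bs : seq 'rV[F]_3) (ps : seq ('rV[F]_3 * 'rV[F]_3)) :
  {in ps, forall p, exists2 b, b \in bs & det3 b p.1 p.2 != 0} ->
  exists t, {in ps, forall p,
    det3 (\sum_(k < size bs) t ^+ k *: bs`_k) p.1 p.2 != 0}.
Proof.
move=> bsP; pose q (p : 'rV[F]_3 * 'rV[F]_3) := \poly_(k < size bs) det3 bs`_k p.1 p.2.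
have [|t /allP nr] := @all_nonroot [seq q p | p <- ps].
  apply/allP => _ /mapP[p /bsP[b bb bp] ->] /=; apply: contra_neq bp => q0.
  have := congr1 (fun r : {poly F} => r`_(index b bs)) q0.
  by rewrite coef0 coef_poly index_mem bb nth_index.
exists t => p pp; have := nr _ (map_f q pp).
rewrite rootE horner_poly det3_sum.
by under eq_bigr do rewrite mulrC.
Qed.

End Specialization.


(** * Realizations and curves joining them *)

Section Realizations.
Variables (F : numFieldType) (d : nat) (M : matroid 'I_d).
Hypothesis simpleM : simple_matroid M.

Definition realizes (a : 'M[F]_(d, 3)) :=
  forall A : {set 'I_d}, dependent M A <-> ~~ free [seq row i a | i in A].

(** Only triples matter for dependency: more than three vectors in three-space are never free, and
    at most two points are never dependent. *)
Lemma realizesP (a : 'M[F]_(d, 3)) :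
  realizes a <->
  (forall A, A \in indep M -> free [seq row i a | i in A]) /\
  (forall i j k, collinear3 M i j k -> det3 (row i a) (row j a) (row k a) = 0).
Proof.
have free_triple i j k : uniq [:: i; j; k] ->
    free [seq row l a | l in [set i; j; k]] = (det3 (row i a) (row j a) (row k a) != 0).
  by move=> U; rewrite (free_image _ U) ?free3 // => l; rewrite !inE orbA.
split=> [aM | [aI aD] A].
  split=> [A AI | i j k].
    by apply/negPn/negP => /aM; rewrite /dependent AI.
  have [[<-|[<-|<-]]|U] : (i = j \/ i = k \/ j = k) \/ uniq [:: i; j; k].
  - rewrite /= !inE negb_or; case: eqVneq => [|_]; first by auto.
    by case: eqVneq => [|_]; [auto | case: eqVneq => [|_]; auto].
  - by rewrite det3_id.
  - by rewrite det3C det3_id oppr0.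
  - by rewrite det3_id23.
  move: (U); rewrite /collinear3 /= !inE negb_or -andbA.
  case/and4P=> /negPf-> /negPf-> /negPf-> _ /aM.
  by rewrite free_triple // negbK => /eqP.
split=> [dA | ]; last by apply: contra => /aI.
apply/negP => fA.
have A3 : (#|A| <= 3)%N.
  rewrite -(size_image (fun i => row i a)) -(eqP fA).
  by apply: leq_trans (dimvS (subvf _)) _; rewrite dimvf dim_matrix.
have : (2 < #|A|)%N by rewrite ltnNge; apply: contra dA; apply: indep_card_le2.
rewrite leq_eqVlt ltnNge A3 orbF eq_sym => /eqP/cards3P[i [j [k [U EA]]]].
move: fA dA; rewrite EA free_triple // => /eqP + dA; apply; apply: aD.
by rewrite /collinear3 dA !orbT.
Qed.

(** The auxiliary vectors complete single vectors and pairs to bases, so that all independence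
    conditions become nonvanishing of a [det3]. *)
Lemma generic_realization (s : seq 'I_d) :
  uniq s -> all_prefix (unique_collinear M) s ->
  exists x : 'I_d -> 'rV[F]_3,
  [/\ {in s & &, forall i j k, (det3 (x i) (x j) (x k) == 0) = collinear3 M i j k},
      {in s &, forall i j, i != j -> det3 (x i) (x j) (delta_mx 0 0) != 0}
    & {in s, forall i, det3 (x i) (delta_mx 0 0) (delta_mx 0 1) != 0}].
Proof.
set e0 : 'rV[F]_3 := delta_mx 0 0; set e1 : 'rV[F]_3 := delta_mx 0 1.
elim: s => [|w s IH] /=; first by move=> _ _; exists (fun=> 0).
case/andP=> ws Us [Pw Ps]; have [x [xD x2 x1]] := IH Us Ps.
have neqw i : i \in s -> w != i by apply: contraTneq => <-.
(* These pairs encode all the nonvanishing conditions that involve the new vector. *)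
pose ps := (e0, e1) :: [seq (x i, e0) | i <- s]
  ++ [seq (x p.1, x p.2) | p <- [seq (i, j) | i <- s, j <- s]
                         & ~~ collinear3 M w p.1 p.2].
suff [v vps vcol] : exists2 v, {in ps, forall p, det3 v p.1 p.2 != 0}
    & {in s &, forall i j, i != j -> collinear3 M w i j -> det3 v (x i) (x j) = 0}.
  exists (fun i => if i == w then v else x i).
  have vE i j : i \in s -> j \in s -> (det3 v (x i) (x j) == 0) = collinear3 M w i j.
    move=> si sj; have [<-|ij] := eqVneq i j.
      by rewrite det3_id23 eqxx /collinear3 eqxx !orbT.
    apply/idP/idP => [|/(vcol _ _ si sj ij)->//]; apply: contraTT => nc.
    apply: (vps (x i, x j)); rewrite inE mem_cat; apply/orP; right; apply/orP; right.
    by apply/mapP; exists (i, j) => //; rewrite mem_filter nc; apply/allpairsP; exists (i, j).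
  have xE i : i \in s -> (if i == w then v else x i) = x i.
    by move/neqw; rewrite eq_sym => /negPf->.
  have v1 i : i \in s -> det3 v (x i) e0 != 0.
    by move=> si; apply: (vps (x i, e0)); rewrite inE mem_cat (map_f (fun i => (x i, e0))) ?orbT.
  split.
  - apply: mem3_cons_ind.
    + by move=> i j; rewrite det3_id /collinear3 !eqxx.
    + by move=> i j k E; rewrite det3C oppr_eq0 collinear3C.
    + by move=> i j k E; rewrite det3CA oppr_eq0 collinear3CA.
    + by move=> i j si sj; rewrite eqxx !xE // vE.
    + by move=> i j k si sj sk; rewrite !xE // xD.
  - move=> i j; rewrite !inE => /predU1P[->|si] /predU1P[->|sj]; rewrite ?eqxx //.
    + by rewrite xE // v1.
    + by rewrite xE // det3CA oppr_eq0 v1.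
    + by rewrite !xE //; apply: x2.
  - move=> i; rewrite inE => /predU1P[->|si]; last by rewrite xE ?x1.
    by rewrite eqxx; apply: (vps (e0, e1)); rewrite mem_head.
have det3C' u v t : det3 u v t != 0 -> det3 t u v != 0.
  by rewrite [det3 t u v]det3CA [det3 u t v]det3C opprK.
have in_ps (P : 'rV[F]_3 -> 'rV[F]_3 -> Prop) :
    P e0 e1 -> {in s, forall i, P (x i) e0} ->
    {in s &, forall i j, ~~ collinear3 M w i j -> P (x i) (x j)} ->
    {in ps, forall p, P p.1 p.2}.
  move=> P1 P2 P3 p; rewrite inE mem_cat => /or3P[/eqP->//|/mapP[i si ->]|].
    exact: P2.
  case/mapP=> q; rewrite mem_filter => /andP[nc /allpairsP[ij [si sj E]]] ->.
  by rewrite E /= in nc *; apply: P3.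
have [/existsP[y /existsP[z]]|free_w] :=
  boolP [exists y, exists z, [&& y \in s, z \in s, y != z & collinear3 M w y z]].
  case/and4P=> ys zs yz cwyz.
  have one_of (P : 'rV[F]_3 -> bool) : P (x y) || P (x z) ->
      exists2 b, b \in [:: x y; x z] & P b.
    case/orP=> Pb; [exists (x y) | exists (x z)] => //; by rewrite !inE eqxx ?orbT.
  have [|t vps] := @generic_combination F [:: x y; x z] ps.
    apply: (in_ps (fun u v => exists2 b, b \in [:: x y; x z] & det3 b u v != 0)).
    - by apply: one_of; rewrite x1.
    - move=> i si; apply: one_of; have [<-|yi] := eqVneq y i; last by rewrite x2.
      by rewrite orbC x2 // eq_sym.
    (* If both [y] and [z] were on the line of [i] and [j], that line would also contain [w]. *)
    - move=> i j si sj nc; apply: one_of; rewrite -negb_and; apply: contra nc.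
      have [<-|ij] := eqVneq i j; first by rewrite /collinear3 eqxx !orbT.
      rewrite !xD // !(collinear3CA _ _ i) ![collinear3 M i _ j]collinear3C.
      case/andP=> cy cz.
      have [ci cj] : collinear3 M i j i /\ collinear3 M i j j.
        by rewrite /collinear3 !eqxx !orbT.
      apply: (collinear3_closed simpleM yz).
      + exact: (collinear3_closed simpleM ij).
      + exact: (collinear3_closed simpleM ij).
      + by rewrite collinear3C collinear3CA.
  exists (\sum_(k < 2) t ^+ k *: [:: x y; x z]`_k) => // i j si sj ij cwij.
  rewrite det3_sum !big_ord_recl big_ord0 /=.
  (* Uniqueness puts [y] and [z] on the line of [i] and [j], so every combination of their vectors
     has zero determinant here. *)
  have cy : collinear3 M i j y by apply: (Pw _ _ _ _ _ yz ij cwyz cwij).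
  have cz : collinear3 M i j z.
    by apply: (Pw z y i j) cwij; rewrite // 1?eq_sym // collinear3C.
  have /eqP -> : det3 (x y) (x i) (x j) == 0 by rewrite xD // collinear3CA collinear3C.
  have /eqP -> : det3 (x z) (x i) (x j) == 0 by rewrite xD // collinear3CA collinear3C.
  by rewrite !mulr0 !addr0.
have nfree i j : i \in s -> j \in s -> i != j -> ~~ collinear3 M w i j.
  move=> si sj ij; apply: contra free_w => c.
  by apply/existsP; exists i; apply/existsP; exists j; rewrite si sj ij.
(* An unconstrained point ranges over the whole space; each kind of pair in [ps] is completed to a
   basis by a standard vector. *)
have [|t vps] := @generic_combination F [:: e0; e1; delta_mx 0 2] ps.
  apply: (in_ps (fun u v => exists2 b, b \in [:: e0; e1; delta_mx 0 2] & det3 b u v != 0)).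
  - exists (delta_mx 0 2); rewrite ?inE ?eqxx ?orbT // /det3 !mxE /=.
    by rewrite !(mulr0, mulr1, subr0, add0r, addr0, oppr0) oner_eq0.
  - by move=> i si; exists e1; rewrite ?inE ?eqxx ?orbT //; apply/det3C'/x1.
  - move=> i j si sj nc; exists e0; rewrite ?mem_head //; apply/det3C'/x2 => //.
    by apply: contraNneq nc => ->; rewrite /collinear3 eqxx !orbT.
exists (\sum_(k < 3) t ^+ k *: [:: e0; e1; delta_mx 0 2]`_k) => // i j si sj ij c.
by rewrite (negPf (nfree i j si sj ij)) in c.
Qed.

Lemma realizable (s : seq 'I_d) :
  (mrank M <= 3)%N -> uniq s -> (forall i, i \in s) ->
  all_prefix (unique_collinear M) s -> exists a, realizes a.
Proof.
move=> rankM Us full Ps; have [x [xD x2 x1]] := generic_realization Us Ps.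
exists (\matrix_i x i).
have rowE i : row i (\matrix_i x i) = x i by rewrite rowK.
apply/realizesP; split=> [A AI | i j k c]; last first.
  by apply/eqP; rewrite !rowE xD.
have freeE (t : seq 'I_d) : uniq t -> A =i t ->
    free [seq row i (\matrix_i x i) | i in A] = free [seq x i | i <- t].
  by move=> Ut At; rewrite (free_image _ Ut At) (eq_map rowE).
have A3 : (#|A| <= 3)%N.
  by apply: leq_trans rankM; apply: leq_bigmax_cond.
case E: #|A| A3 => [|[|[|[|//]]]] _.
- rewrite (freeE [::]) ?nil_free // => i.
  by have /eqP := E; rewrite cards_eq0 => /eqP->; rewrite inE.
- have /eqP/cards1P[i Ai] := E; rewrite (freeE [:: i]) //; last by move=> l; rewrite Ai !inE.
  by apply: (@catl_free _ _ [:: delta_mx 0 0; delta_mx 0 1]); rewrite free3 x1.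
- have /eqP/cards2P[i [j [ij Aij]]] := E.
  rewrite (freeE [:: i; j]) /= ?inE ?ij //; last by move=> l; rewrite Aij !inE.
  by apply: (@catl_free _ _ [:: delta_mx 0 0]); rewrite free3 x2.
have [i [j [k [U Aijk]]]] := cards3P E.
rewrite (freeE [:: i; j; k]) //; last by move=> l; rewrite Aijk !inE orbA.
rewrite free3 xD // /collinear3 /dependent -Aijk AI orbF.
by move: U; rewrite /= !inE !negb_or -andbA => /and4P[-> -> ->].
Qed.

(** The vectors of [y] and [z] are free because pairs are independent, so the dependency can be
    solved for that of [w]. *)
Lemma realizes_span (a : 'M[F]_(d, 3)) w y z :
  realizes a -> w != y -> w != z -> y != z -> collinear3 M w y z ->
  exists p, row w a = p.1 *: row y a + p.2 *: row z a.
Proof.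
move/realizesP=> [aI aD] wy wz yz /aD/eqP; rewrite -[_ == 0]negbK -free3 free_cons.
have -> : free [:: row y a; row z a].
  rewrite -[[:: _; _]]/[seq row i a | i <- [:: y; z]] -(@free_image _ _ _ _ [set y; z]).
  - by apply/aI/indep_card_le2; rewrite // cards2 yz.
  - by rewrite /= inE yz.
  - by move=> i; rewrite !inE.
rewrite andbT negbK span_cons span_seq1.
case/memv_addP=> _ /vlineP[p ->] [_ /vlineP[q ->] ->].
by exists (p, q).
Qed.

(* The parameters expressing a point in terms of two earlier ones on its line
   are interpolated linearly, so collinear triples stay dependent along the
   whole curve. *)
Lemma collinear_curve (a b : 'M[F]_(d, 3)) (s : seq 'I_d) :
  realizes a -> realizes b -> uniq s -> all_prefix (unique_collinear M) s ->
  exists c : 'I_d -> 'rV[{poly F}]_3,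
  [/\ {in s, forall i, map_mx (horner_eval 0) (c i) = row i a},
      {in s, forall i, map_mx (horner_eval 1) (c i) = row i b}
    & {in s & &, forall i j k, collinear3 M i j k -> det3 (c i) (c j) (c k) = 0}].
Proof.
move=> ra rb; elim: s => [|w s IH] /=; first by exists (fun=> 0).
case/andP=> ws Us [Pw Ps]; have [c [c0 c1 cD]] := IH Us Ps.
have neqw i : i \in s -> w != i by apply: contraTneq => <-.
suff [v [v0 v1 vD]] : exists v : 'rV[{poly F}]_3,
    [/\ map_mx (horner_eval 0) v = row w a, map_mx (horner_eval 1) v = row w b
      & {in s &, forall i j, i != j -> collinear3 M w i j -> det3 v (c i) (c j) = 0}].
  have cE i : i \in s -> (if i == w then v else c i) = c i.
    by move/neqw; rewrite eq_sym => /negPf->.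
  exists (fun i => if i == w then v else c i); split.
  - by move=> i; rewrite inE => /predU1P[->|si]; [rewrite eqxx | rewrite cE ?c0].
  - by move=> i; rewrite inE => /predU1P[->|si]; [rewrite eqxx | rewrite cE ?c1].
  apply: mem3_cons_ind.
  - by move=> i j; rewrite det3_id.
  - by move=> i j k E; rewrite det3C collinear3C => /E->; rewrite oppr0.
  - by move=> i j k E; rewrite det3CA collinear3CA => /E->; rewrite oppr0.
  - move=> i j si sj; rewrite eqxx !cE //.
    by have [->|ij] := eqVneq i j; [rewrite det3_id23 | apply: vD].
  - by move=> i j k si sj sk; rewrite !cE //; apply: cD.
have [/existsP[y /existsP[z]]|free_w] :=
  boolP [exists y, exists z, [&& y \in s, z \in s, y != z & collinear3 M w y z]].
  case/and4P=> ys zs yz cwyz.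
  have [p pE] := realizes_span ra (neqw y ys) (neqw z zs) yz cwyz.
  have [q qE] := realizes_span rb (neqw y ys) (neqw z zs) yz cwyz.
  pose join (u v : F) : {poly F} := u%:P * (1 - 'X) + v%:P * 'X.
  have join0 u v : horner_eval 0 (join u v) = u by rewrite /horner_eval /join !hornerE; ring.
  have join1 u v : horner_eval 1 (join u v) = v by rewrite /horner_eval /join !hornerE; ring.
  exists (join p.1 q.1 *: c y + join p.2 q.2 *: c z); split.
  - by rewrite map_mxD !map_mxZ /= !join0 !c0.
  - by rewrite map_mxD !map_mxZ /= !join1 !c1.
  move=> i j si sj ij cwij; rewrite det3D !det3Z.
  have cy : collinear3 M i j y by apply: (Pw _ _ _ _ _ yz ij cwyz cwij).
  have cz : collinear3 M i j z.
    by apply: (Pw z y i j) cwij; rewrite // 1?eq_sym // collinear3C.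
  by rewrite !cD ?mulr0 ?addr0 // collinear3CA collinear3C.
exists (\row_k ((row w a 0 k)%:P * (1 - 'X) + (row w b 0 k)%:P * 'X)); split.
- by apply/rowP => k; rewrite !mxE /horner_eval !hornerE; ring.
- by apply/rowP => k; rewrite !mxE /horner_eval !hornerE; ring.
move=> i j si sj ij c'; case/negP: free_w.
by apply/existsP; exists i; apply/existsP; exists j; rewrite si sj ij.
Qed.

(** Dependencies hold identically along the curve. Each independent set stays free off the roots of
    a nonzero polynomial, and [h] is the product of these. *)
Lemma realization_curve (a b : 'M[F]_(d, 3)) (s : seq 'I_d) :
  realizes a -> realizes b -> uniq s -> (forall i, i \in s) ->
  all_prefix (unique_collinear M) s ->
  exists (c : 'M[{poly F}]_(d, 3)) (h : {poly F}),
  [/\ map_mx (horner_eval 0) c = a, map_mx (horner_eval 1) c = b, h != 0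
    & forall t, ~~ root h t -> realizes (map_mx (horner_eval t) c)].
Proof.
move=> ra rb Us full Ps; have [x [x0 x1 xD]] := collinear_curve ra rb Us Ps.
pose c := \matrix_i x i.
have c0 : map_mx (horner_eval 0) c = a.
  by apply/row_matrixP => i; rewrite -map_row rowK x0.
have c1 : map_mx (horner_eval 1) c = b.
  by apply/row_matrixP => i; rewrite -map_row rowK x1.
have hA (A : {set 'I_d}) : exists h : {poly F}, h != 0 /\ (A \in indep M ->
    forall t, ~~ root h t -> free [seq row i (map_mx (horner_eval t) c) | i in A]).
  (* A dependent set imposes no condition and gets the constant 1. *)
  have [AI|_] := boolP (A \in indep M); last by exists 1; rewrite oner_eq0.
  have [aI _] := (realizesP a).1 ra.
  have := aI A AI; rewrite free_image_rows -c0 -map_mxsub => /row_free_curve[h h0 hP].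
  by exists h; split=> // _ t /hP; rewrite map_mxsub -free_image_rows.
have [h hP] := fin_all_exists hA.
exists c, (\prod_A h A); split=> //; first by apply/prodf_neq0 => A _; case: (hP A).
move=> t; rewrite rootE horner_prod => /prodf_neq0 nr.
apply/realizesP; split=> [A AI | i j k /xD xE].
  by apply: (hP A).2 => //; rewrite rootE nr.
by rewrite -!map_row !rowK det3_map xE ?full // rmorph0.
Qed.

End Realizations.

(** * Irreducibility of the matroid variety *)

Lemma not_sub_zero_locus (F : fieldType) d n (A : set 'M[F]_(d, n)) P :
  ~ (A `<=` zero_locus P)%classic ->
  exists a f, [/\ A a, P f & f.@[fun k => mxvec a 0 k] != 0].
Proof.
move=> nsub; apply: boolp.contrapT => H; apply: nsub => a Aa f Pf.
by apply/eqP; apply: boolp.contrapT => /negP f0; apply: H; exists a, f.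
Qed.

Theorem theorem3p11 (R : realType) (d : nat) (M : matroid 'I_d)
    (cactusM : cactus M) :
  (exists a, realization_space R M a)
  /\ zariski_irreducible (matroid_variety R M).
Proof.
have [/andP[simpleM rankM] _] := cactusM.
have [s [Us full Ps]] := cactus_order cactusM.
have [a ra] := realizable R[i] simpleM rankM Us full Ps.
split; first by exists a.
split=> [|Z1 Z2 cZ1 cZ2 sub]; first by exists a => Z _; apply.
have subV Z : zariski_closed Z -> (realization_space R M `<=` Z)%classic ->
    (matroid_variety R M `<=` Z)%classic by move=> cZ sZ b; apply.
have [/(subV _ cZ1)|nZ1] := boolp.EM (realization_space R M `<=` Z1)%classic; first by left.
have [/(subV _ cZ2)|nZ2] := boolp.EM (realization_space R M `<=` Z2)%classic; first by right.
case: cZ1 cZ2 nZ1 nZ2 sub => [P1 ->] [P2 ->].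
case/not_sub_zero_locus=> a1 [f1 [r1 Pf1 nz1]] /not_sub_zero_locus[a2 [f2 [r2 Pf2 nz2]]] sub.
have [c [h [c0 c1 h0 hP]]] := realization_curve simpleM r1 r2 Us full Ps.
(* This is [f] restricted to the curve; its value at 0 shows [q f1] nonzero, its value at 1 does so
   for [q f2]. *)
pose q (f : {mpoly R[i][d * 3]}) := mmap polyC (fun k => mxvec c 0 k) f.
have q1 : q f1 != 0.
  by apply: contra_neq nz1 => q0; rewrite -c0 -horner_mmap_curve -/(q _) q0 horner0.
have q2 : q f2 != 0.
  by apply: contra_neq nz2 => q0; rewrite -c1 -horner_mmap_curve -/(q _) q0 horner0.
(* Such a [t] gives a realization lying in neither zero locus. *)
have [|t] := @all_nonroot R[i] [:: h; q f1; q f2]; first by rewrite /= h0 q1 q2.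
rewrite /= andbT => /and3P[/hP rt]; rewrite !rootE !horner_mmap_curve => t1 t2.
have Vt : matroid_variety R M (map_mx (horner_eval t) c) by move=> Z _; apply.
by case: (sub _ Vt) => zt; [move: t1 | move: t2]; rewrite zt ?eqxx.
Qed.
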